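(* There exist (simple) quantum graphs of the form $X_{A,B}$ that are not colourable: there are $n\ge2$ and matrices $A,B\in M_n$ with equal diagonals such that $X_{A,B}$ is an undirected loopless quantum graph on $M_n$ which has no $k$-colouring for any $k\in\mathbb N$.
   Context: $M_n=M_n(\mathbb C)$, with matrix units $E_{ij}$; ''projector'' means orthogonal projector. For $A,B\in M_n$ with $\operatorname{diag}A=\operatorname{diag}B$, $X_{A,B}(x)=\sum_{i\ne j}A_{ij}x_{jj}E_{ii}+\sum_{i,j}B_{ij}x_{ij}E_{ij}$. A quantum graph on $M_n$ is a linear map $G\colon M_n\to M_n$ with $\sum_{k} G(E_{ik})G(E_{kj})=G(E_{ij})$ for all $i,j$ and $G(x^\dagger)=G(x)^\dagger$; it is undirected if self-adjoint for $\langle x,y\rangle=\mathrm{Tr}(x^\dagger y)$, and loopless if $\sum_k G(E_{ik})E_{kj}=0$ for all $i,j$. The realignment $G^R$ is defined by $(G^R)_{(a,b),(c,d)}=G_{(d,b),(c,a)}$, where $G_{(a,b),(c,d)}$ is the coefficient of $E_{ab}$ in $G(E_{cd})$; $G^R$ is a projector on $M_n$, and $S=\operatorname{img}G^R$ is the operator space of $G$. For $X_{A,B}$ undirected and loopless, $S=\operatorname{span}\{E_{ij}: i\neq j, A_{ij}\ne0\}\oplus\{\operatorname{diag}(v):v\in\operatorname{img}B\}$. A $k$-colouring of $G$ is a family of projectors $P_1,\dots,P_k$ on $\mathbb C^n$ with $\sum_sP_s=I$ and $P_sxP_s=0$ for all $x\in S$ and all $s$. *)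

(* Defs.v *)
From HB Require Import structures.
From mathcomp Require Import all_boot all_order all_algebra.
From mathcomp Require Import complex reals.

Set Implicit Arguments.
Unset Strict Implicit.
Unset Printing Implicit Defensive.

Import GRing.Theory Num.Theory.
Local Open Scope ring_scope.
Local Open Scope sesquilinear_scope.

(* The matrix unit E_ij is [delta_mx i j]; x^dagger is [x ^t*]. *)

Section QuantumGraphs.
Variables (C : numClosedFieldType) (n : nat).
Implicit Types (A B P x y : 'M[C]_n) (G : {linear 'M[C]_n -> 'M[C]_n}).

Definition XAB A B x : 'M[C]_n :=
  \sum_i \sum_(j | i != j) (A i j * x j j) *: delta_mx i i
  + \sum_i \sum_j (B i j * x i j) *: delta_mx i j.

Fact XAB_is_linear A B : linear (XAB A B).
Proof.
move=> a x y; rewrite /XAB scalerDr addrACA; congr (_ + _).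
  rewrite scaler_sumr -big_split; apply: eq_bigr => i _ /=.
  rewrite scaler_sumr -big_split; apply: eq_bigr => j _ /=.
  by rewrite scalerA -scalerDl !mxE mulrDr mulrCA.
rewrite scaler_sumr -big_split; apply: eq_bigr => i _ /=.
rewrite scaler_sumr -big_split; apply: eq_bigr => j _ /=.
by rewrite scalerA -scalerDl !mxE mulrDr mulrCA.
Qed.

HB.instance Definition _ A B :=
  GRing.isLinear.Build C 'M[C]_n 'M[C]_n *:%R (XAB A B) (XAB_is_linear A B).

Definition quantum_graph G : Prop :=
  (forall i j : 'I_n,
     \sum_k G (delta_mx i k) *m G (delta_mx k j) = G (delta_mx i j)) /\
  (forall x, G (x ^t*) = (G x) ^t*).

Definition undirected G : Prop :=
  forall x y, \tr (x ^t* *m G y) = \tr ((G x) ^t* *m y).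

Definition loopless G : Prop :=
  forall i j : 'I_n, \sum_k G (delta_mx i k) *m delta_mx k j = 0.

(* [superop_coef G a b c d] is the coefficient of E_ab in G(E_cd). *)
Definition superop_coef G (a b c d : 'I_n) : C := G (delta_mx c d) a b.

(* The linear map whose ((a, b), (c, d)) entry in the basis of matrix units
   is [superop_coef G d b c a]. *)
Definition realign G x : 'M[C]_n :=
  \matrix_(a, b) \sum_c \sum_d superop_coef G d b c a * x c d.

Fact realign_is_linear G : linear (realign G).
Proof.
move=> k x y; apply/matrixP => a b; rewrite !mxE mulr_sumr -big_split /=.
apply: eq_bigr => c _; rewrite mulr_sumr -big_split /=.
by apply: eq_bigr => d _; rewrite !mxE mulrDr mulrCA.
Qed.

HB.instance Definition _ G :=
  GRing.isLinear.Build C 'M[C]_n 'M[C]_n *:%R (realign G) (realign_is_linear G).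

Definition operator_space G : {vspace 'M[C]_n} := limg (linfun (realign G)).

Definition projector P : Prop := P *m P = P /\ P ^t* = P.

Definition colouring G (k : nat) (P : 'I_k -> 'M[C]_n) : Prop :=
  [/\ forall s, projector (P s),
      \sum_s P s = 1%:M &
      forall x, x \in operator_space G -> forall s, P s *m x *m P s = 0].

End QuantumGraphs.

(* Main.v *)
Require Import Defs.
From mathcomp Require Import all_boot all_order all_algebra.
From mathcomp Require Import complex reals.

(** The loopless complete quantum graph [x |-> tr(x) 1 - x / n] is of the form
    [X_{A,B}], and its operator space contains all traceless matrices.  If
    [P x P = 0] for all traceless [x], then [P_ai P_jb = 0] for [i != j] and
    [P_ai P_ib] does not depend on [i]; hence the square of the latter is
    [(P_ai P_jb) (P_aj P_ib) = 0], so that [P = P P = 0] once [n >= 2].  Zero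
    projectors do not sum to the identity. *)

Import GRing.Theory Num.Theory.
Local Open Scope ring_scope.
Local Open Scope sesquilinear_scope.

Section CompleteQuantumGraph.
Variables (C : numClosedFieldType) (n : nat).
Implicit Types (x y P : 'M[C]_n) (i j a b : 'I_n).

(** [XAB] sums A_ij x_jj over j != i only; the missing x_ii of the trace comes from the diagonal of
    [complete_B], which [complete_A] shares. *)
Definition complete_A : 'M[C]_n :=
  \matrix_(i, j) (if i == j then 1 - n%:R^-1 else 1).
Definition complete_B : 'M[C]_n :=
  \matrix_(i, j) ((i == j)%:R - n%:R^-1).

Local Notation G := (XAB complete_A complete_B).

(** An index [i : 'I_n] witnesses n > 0, and [C] has characteristic 0. *)
Lemma ord_natr_neq0 i : (n%:R : C) != 0.
Proof. by rewrite pnatr_eq0 -lt0n; case: i => m /(leq_trans _); apply. Qed.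

Lemma complete_XAB x : G x = (\tr x)%:M - n%:R^-1 *: x.
Proof.
apply/matrixP => a b; rewrite /XAB !mxE !summxE.
under eq_bigr do rewrite summxE.
under [X in _ + X]eq_bigr do rewrite summxE.
rewrite (bigD1 a) //= [X in _ + X + _]big1 ?addr0; last first.
  by move=> i /negPf nia; rewrite big1 // => j _; rewrite !mxE [a == i]eq_sym nia mulr0.
rewrite [X in _ + X](bigD1 a) //= [X in _ + (_ + X)]big1 ?addr0; last first.
  by move=> i /negPf nia; rewrite big1 // => j _; rewrite !mxE [a == i]eq_sym nia mulr0.
rewrite [X in _ + X](bigD1 b) //= [X in _ + (_ + X)]big1 ?addr0; last first.
  move=> j /negPf njb.
  by rewrite !mxE [b == j]eq_sym njb andbF mulr0.
rewrite !mxE !eqxx mulr1 mulrBl addrA; congr (_ - _).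
have [<-|nab] := eqVneq a b; last first.
  rewrite mul0r addr0 big1 // => j _.
  by rewrite !mxE [b == a]eq_sym (negPf nab) andbF mulr0.
rewrite mul1r mulr1n addrC /mxtrace [RHS](bigD1 a) //=; congr (_ + _).
apply: eq_big => [j|j naj]; first by rewrite eq_sym.
by rewrite !mxE (negPf naj) eqxx !mulr1 mul1r.
Qed.

Lemma mxtrace_delta i j : \tr (delta_mx i j : 'M[C]_n) = (i == j)%:R.
Proof.
rewrite /mxtrace (bigD1 i) //= big1 ?addr0 => [|k /negPf nki].
  by rewrite mxE eqxx.
by rewrite mxE nki.
Qed.

Lemma complete_XAB_delta i j :
  G (delta_mx i j) = (i == j)%:R%:M - n%:R^-1 *: delta_mx i j.
Proof. by rewrite complete_XAB mxtrace_delta. Qed.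

(** The trace part contributes E_ij, from k = i alone; the other part subtracts E_ij / n once for
    each of the n values of k. *)
Lemma complete_loopless : loopless G.
Proof.
move=> i j /=.
under eq_bigr do rewrite complete_XAB_delta mulmxBl mul_scalar_mx
  -scalemxAl mul_delta_mx.
rewrite sumrB (bigD1 i) //= eqxx scale1r big1 ?addr0; last first.
  by move=> k /negPf nki; rewrite eq_sym nki scale0r.
rewrite sumr_const card_ord -scaler_nat scalerA divff ?(ord_natr_neq0 i) //.
by rewrite scale1r subrr.
Qed.

Lemma complete_quantum_graph : quantum_graph G.
Proof.
split=> [i j|x] /=.
  (* The part of [G (delta_mx k j)] along [delta_mx k j] contributes nothing
     to the sum, by looplessness. *)
  under eq_bigr => k _ do rewrite [G (delta_mx k j)]complete_XAB_delta
    mulmxBr mul_mx_scalar -scalemxAr.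
  rewrite sumrB -scaler_sumr complete_loopless scaler0 subr0.
  rewrite (bigD1 j) //= eqxx scale1r big1 ?addr0 // => k /negPf nkj.
  by rewrite nkj scale0r.
rewrite !complete_XAB; apply/matrixP => a b; rewrite !mxE rmorphB rmorphM /=.
rewrite fmorphV rmorph_nat [a == b]eq_sym rmorphMn /=; congr (_ *+ _ - _).
by rewrite /mxtrace rmorph_sum; apply: eq_bigr => k _; rewrite !mxE.
Qed.

(** As [G] commutes with the adjoint, both sides equal tr(x^dagger) tr(y) - tr(x^dagger y) / n. *)
Lemma complete_undirected : undirected G.
Proof.
have [_ /= adjG] := complete_quantum_graph.
move=> x y /=; rewrite -adjG !complete_XAB.
rewrite mulmxBr mulmxBl !linearB /= mul_mx_scalar mul_scalar_mx.
by rewrite -scalemxAl -scalemxAr !linearZ /= mulrC.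
Qed.

(** The realignment of [G] maps x to x - (tr x / n) 1, so it fixes every traceless x. *)
Lemma traceless_operator_space x : \tr x = 0 -> x \in operator_space G.
Proof.
move=> trx0; suff <-: linfun (realign G) x = x by rewrite memv_img ?memvf.
rewrite lfunE /=; apply/matrixP => a b; rewrite !mxE /superop_coef.
transitivity (\sum_c \sum_d ((c == a)%:R * (d == b)%:R * x c d
    - (c == d)%:R * x c d * (n%:R^-1 * (a == b)%:R))).
  apply: eq_bigr => c _; apply: eq_bigr => d _.
  rewrite /= complete_XAB_delta !mxE mulrBl; congr (_ - _); first by rewrite mulr_natr.
  rewrite [d == c]eq_sym [b == a]eq_sym -mulnb natrM.
  by rewrite [RHS]mulrC !mulrA [X in X * _]mulrAC.
under eq_bigr do rewrite sumrB -mulr_suml.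
rewrite sumrB -mulr_suml.
have -> : \sum_c \sum_d (c == d)%:R * x c d = \tr x.
  apply: eq_bigr => c _; rewrite (bigD1 c) //= eqxx mul1r big1 ?addr0 // => d.
  by rewrite eq_sym => /negPf->; rewrite mul0r.
rewrite trx0 mul0r subr0 (bigD1 a) //= [X in _ + X]big1 ?addr0; last first.
  by move=> c /negPf->; rewrite big1 // => d _; rewrite !mul0r.
rewrite (bigD1 b) //= big1 ?addr0 => [|d /negPf->]; last by rewrite mulr0 mul0r.
by rewrite !eqxx !mul1r.
Qed.

Lemma mulmx_delta_mulmx P i j a b :
  (P *m delta_mx i j *m P) a b = P a i * P j b.
Proof.
(* Factoring E_ij through ['I_1] as a column times a row turns the product into column i of P times
   row j of P. *)
rewrite -(mul_delta_mx (0 : 'I_1)) mulmxA -mulmxA -colE -rowE.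
by rewrite mxE big_ord1 !mxE.
Qed.

Lemma idempotent_compress_traceless P : (1 < n)%N -> P *m P = P ->
  (forall x, \tr x = 0 -> P *m x *m P = 0) -> P = 0.
Proof.
move=> n_gt1 PP P0.
have offdiag i j a b : i != j -> P a i * P j b = 0.
  move=> /negPf nij; rewrite -mulmx_delta_mulmx P0 ?mxE //.
  by rewrite mxtrace_delta nij.
have diag i j a b : P a i * P i b = P a j * P j b.
  apply/eqP; rewrite -!mulmx_delta_mulmx -subr_eq0; apply/eqP.
  have := P0 (delta_mx i i - delta_mx j j).
  rewrite linearB /= !mxtrace_delta !eqxx subrr mulmxBr mulmxBl => /(_ erefl).
  by move=> /matrixP/(_ a b); rewrite !mxE.
(* Each summand P_ai P_ib of the entry (a, b) of P P is shown to vanish separately. *)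
apply/matrixP => a b; rewrite -PP !mxE big1 // => i _.
(* [Ordinal n_gt1] is the index 1: it serves as j unless i = 1, in which case j = 0 does. *)
have [j nij] : exists j, i != j.
  have [<-|] := eqVneq (Ordinal n_gt1) i; last first.
    by rewrite eq_sym; exists (Ordinal n_gt1).
  by exists (Ordinal (ltnW n_gt1)).
apply/eqP; rewrite -sqrf_eq0 expr2 {2}(diag i j).
by rewrite [P a j * _]mulrC mulrACA offdiag ?mul0r.
Qed.

Lemma complete_not_colourable k (P : 'I_k -> 'M[C]_n) :
  (1 < n)%N -> ~ colouring G P.
Proof.
move=> n_gt1 [Pproj sumP PS].
have P0 s : P s = 0.
  apply: idempotent_compress_traceless => // [|x /traceless_operator_space xS].
    by case: (Pproj s).
  exact: PS.
(* A diagonal entry of the sum, which is empty when k = 0, would give 0 = 1. *)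
move: sumP; rewrite big1 // => /matrixP/(_ (Ordinal n_gt1) (Ordinal n_gt1)).
by rewrite !mxE eqxx => /eqP; rewrite eq_sym oner_eq0.
Qed.

End CompleteQuantumGraph.

Theorem proposition4p18 (R : realType) :
  exists (n : nat) (A B : 'M[R[i]]_n),
    [/\ (2 <= n)%N,
        forall i, A i i = B i i,
        [/\ quantum_graph (XAB A B), undirected (XAB A B)
          & loopless (XAB A B)]
      & forall (k : nat) (P : 'I_k -> 'M[R[i]]_n), ~ colouring (XAB A B) P].
Proof.
(* The least size to which the argument applies. *)
exists 2%N, (complete_A _ _), (complete_B _ _); split=> //.
- by move=> i; rewrite !mxE eqxx.
- split; [exact: complete_quantum_graph | exact: complete_undirected
         | exact: complete_loopless].
- by move=> k P; apply: complete_not_colourable.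
Qed.
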